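(* Let $\mathfrak g=\mathfrak g_3\oplus\mathfrak g_1$ be a real Lie algebra, where $\mathfrak g_3$ is a simple three-dimensional real Lie algebra and $\mathfrak g_1=\mathbb R$, let $\pi:\mathfrak g\to\mathfrak g_3$ be the projection, and let $k$ be the Killing form of $\mathfrak g_3$. Then $\mathfrak g$ has a two-dimensional generating subspace. In addition, a two-dimensional subspace $\mathfrak p\subset\mathfrak g$ generates $\mathfrak g$ if and only if 1) $\mathfrak p_1:=\pi(\mathfrak p)\ne\mathfrak p$; 2) $\mathfrak p_1$ is two-dimensional; 3) the restriction of $k$ to $\mathfrak p_1$ is non-degenerate. For $\mathfrak g_{3,7}\oplus\mathfrak g_1$ there exists exactly one equivalence class of such subspaces $\mathfrak p\subset\mathfrak g$, and for $\mathfrak g_{3,6}\oplus\mathfrak g_1$ there exist exactly four. Moreover, for each such $\mathfrak p$ there exist basis vectors $e_1,e_2$ of $\mathfrak p$, unique up to multiplication by nonzero real numbers, such that either (i) $e_1\in\mathfrak g_3$, $e_2\notin\mathfrak g_3$ and $k(e_1,\pi(e_2))=0$, or (ii) $e_1\notin\mathfrak g_3$, $e_2\in\mathfrak g_3$ and both vectors $\pi(e_1)$, $e_2$ are isotropic. In addition, with $e_3:=[e_1,e_2]$, $e_4:=[e_1,e_3]$, the vectors $(e_1,e_2,e_3,e_4)$ form a basis of $\mathfrak g$ with $C_{23}^4=0$; in case (i) $[e_2,e_3]$ is a nonzero multiple of $e_1$, i.e. $C^1_{23}\ne0$, $C^2_{23}=C^3_{23}=0$, and in case (ii) $[e_2,e_3]$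 is a nonzero multiple of $e_2$, i.e. $C^2_{23}\neq0$, $C^1_{23}=C^3_{23}=0$.
   Context: A subspace $\mathfrak p$ is generating if the smallest Lie subalgebra containing it is $\mathfrak g$. Two subspaces are equivalent if some automorphism of the Lie algebra $\mathfrak g$ maps one onto the other. $C_{ij}^k$ are the structure constants: $[e_i,e_j]=\sum_kC_{ij}^ke_k$. A vector $v\in\mathfrak g_3$ is isotropic if $k(v,v)=0$. The simple three-dimensional real Lie algebras are $\mathfrak g_{3,6}=\mathfrak{sl}(2,\mathbb R)$, with basis satisfying $[E_2,E_3]=E_1$, $[E_3,E_1]=E_2$, $[E_1,E_2]=-E_3$, and $\mathfrak g_{3,7}=\mathfrak{so}(3)=\mathfrak{su}(2)$, with basis satisfying $[E_2,E_3]=E_1$, $[E_3,E_1]=E_2$, $[E_1,E_2]=E_3$. The subalgebra $\mathfrak g_3$ is identified with $\mathfrak g_3\oplus 0\subset\mathfrak g$. *)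

(* Defs.v *)
From HB Require Import structures.
From mathcomp Require Import all_boot all_order all_algebra reals.

Set Implicit Arguments.
Unset Strict Implicit.
Unset Printing Implicit Defensive.

Import GRing.Theory.
Local Open Scope ring_scope.

HB.mixin Record isLieAlgebra (F : fieldType) V & Vector F V := {
  bracket : V -> V -> V;
  bracket_linearl : forall y : V, linear (fun x => bracket x y);
  bracket_linearr : forall x : V, linear (bracket x);
  bracketxx : forall x : V, bracket x x = 0;
  bracket_jacobi : forall x y z : V,
    bracket x (bracket y z) + bracket y (bracket z x)
      + bracket z (bracket x y) = 0
}.

#[short(type="lieAlgType")]
HB.structure Definition LieAlgebra (F : fieldType) :=
  {V of isLieAlgebra F V & Vector F V}.

Notation "[< x , y >]" := (bracket x y)
  (at level 0, x, y at level 99, format "[<  x ,  y  >]") : ring_scope.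

(* The one-dimensional Lie algebra g_1: the line F^o with zero bracket. *)
Section OneDimensional.
Variable F : fieldType.

Definition abelian_bracket (x y : F^o) : F^o := 0.

Fact abelian_linearl y : linear (fun x => abelian_bracket x y).
Proof. by move=> a u v; rewrite /abelian_bracket scaler0 addr0. Qed.

Fact abelian_linearr x : linear (abelian_bracket x).
Proof. by move=> a u v; rewrite /abelian_bracket scaler0 addr0. Qed.

Fact abelian_xx x : abelian_bracket x x = 0.
Proof. by []. Qed.

Fact abelian_jacobi x y z :
  abelian_bracket x (abelian_bracket y z)
    + abelian_bracket y (abelian_bracket z x)
    + abelian_bracket z (abelian_bracket x y) = 0.
Proof. by rewrite /abelian_bracket !addr0. Qed.

HB.instance Definition _ := isLieAlgebra.Build F F^o
  abelian_linearl abelian_linearr abelian_xx abelian_jacobi.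

End OneDimensional.

Section DirectSum.
Variables (F : fieldType) (L M : lieAlgType F).

Definition prod_bracket (x y : L * M) : L * M :=
  ([< x.1, y.1 >], [< x.2, y.2 >]).

Fact prod_linearl y : linear (fun x => prod_bracket x y).
Proof.
move=> a u v; rewrite /prod_bracket /=.
have := bracket_linearl y.1 a u.1 v.1; rewrite /= => ->.
by have := bracket_linearl y.2 a u.2 v.2; rewrite /= => ->.
Qed.

Fact prod_linearr x : linear (prod_bracket x).
Proof. by move=> a u v; rewrite /prod_bracket /= !bracket_linearr. Qed.

Fact prod_xx x : prod_bracket x x = 0.
Proof. by rewrite /prod_bracket !bracketxx. Qed.

Fact prod_jacobi x y z :
  prod_bracket x (prod_bracket y z) + prod_bracket y (prod_bracket z x)
    + prod_bracket z (prod_bracket x y) = 0.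
Proof.
by case: x y z => [? ?] [? ?] [? ?]; congr (_, _); apply: bracket_jacobi.
Qed.

HB.instance Definition _ := isLieAlgebra.Build F (L * M)%type
  prod_linearl prod_linearr prod_xx prod_jacobi.

End DirectSum.

Section LieTheory.
Variables (F : fieldType) (L : lieAlgType F).
Implicit Types (U W I p q : {vspace L}) (x y : L).

Definition subalgebra U : Prop :=
  forall x y, x \in U -> y \in U -> [< x, y >] \in U.

Definition ideal I : Prop := forall x y, y \in I -> [< x, y >] \in I.

Definition simple_lie : Prop :=
  (exists x y, [< x, y >] != 0)
  /\ (forall I, ideal I -> I = 0%VS \/ I = fullv).

Definition smallest_subalgebra p U : Prop :=
  [/\ subalgebra U, (p <= U)%VS
    & forall W, subalgebra W -> (p <= W)%VS -> (U <= W)%VS].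

Definition generating p : Prop := smallest_subalgebra p fullv.

Definition automorphism (f : 'End(L)) : Prop :=
  bijective f /\ (forall x y, f [< x, y >] = [< f x, f y >]).

Definition equivalent p q : Prop :=
  exists2 f : 'End(L), automorphism f & (f @: p)%VS = q.

(* The subspaces satisfying P form exactly n equivalence classes:
   q is a complete, irredundant system of representatives. *)
Definition exactly_n_classes (P : {vspace L} -> Prop) (n : nat) : Prop :=
  exists q : 'I_n -> {vspace L},
    [/\ forall i, P (q i),
        forall i j, equivalent (q i) (q j) -> i = j
      & forall p, P p -> exists i, equivalent p (q i)].

HB.instance Definition _ x :=
  GRing.isLinear.Build F L L *:%R (bracket x) (bracket_linearr x).

Definition ad x : 'End(L) := linfun (bracket x).

Fact adE x y : ad x y = [< x, y >].
Proof. by rewrite lfunE. Qed.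

Definition lfun_trace (f : 'End(L)) : F :=
  \tr (passmx.mxof (vbasis {:L}) (vbasis {:L}) f).

Definition killing x y : F := lfun_trace (ad x \o ad y)%VF.

Definition isotropic x : Prop := killing x x = 0.

Definition killing_nondegenerate_on U : Prop :=
  forall x, x \in U -> (forall y, y \in U -> killing x y = 0) -> x = 0.

(* The C_ij^k of the basis e; indices are 0-based here, so that C_23^4 is
   obtained for the ordinals i, j, k of values 1, 2, 3. *)
Definition struct_const n (e : n.-tuple L) (i j k : 'I_n) : F :=
  coord e k [< e`_i, e`_j >].

(* The algebras g_{3,6} = sl(2) and g_{3,7} = so(3), up to isomorphism. *)
Definition is_g36 : Prop :=
  exists E1 E2 E3 : L,
    basis_of fullv [:: E1; E2; E3] /\
    [/\ [< E2, E3 >] = E1, [< E3, E1 >] = E2 & [< E1, E2 >] = - E3].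

Definition is_g37 : Prop :=
  exists E1 E2 E3 : L,
    basis_of fullv [:: E1; E2; E3] /\
    [/\ [< E2, E3 >] = E1, [< E3, E1 >] = E2 & [< E1, E2 >] = E3].

End LieTheory.

Section Extension.
Variables (R : realType) (g3 : lieAlgType R).

(* g = g_3 (+) R; g_3 is identified with its image under ext_inj. *)
Definition ext1 : lieAlgType R := (g3 * R^o)%type.

Definition ext_proj : 'Hom(ext1, g3) := linfun (fun v : g3 * R^o => v.1).

Definition inj_fun (x : g3) : ext1 := (x, 0 : R^o).

Fact inj_fun_linear : linear inj_fun.
Proof. by move=> a u v; congr (_, _); rewrite /= scaler0 addr0. Qed.

HB.instance Definition _ :=
  GRing.isLinear.Build R g3 ext1 *:%R inj_fun inj_fun_linear.

Definition ext_inj : 'Hom(g3, ext1) := linfun inj_fun.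

Fact ext_projE (v : ext1) : ext_proj v = v.1.
Proof. by rewrite lfunE. Qed.

Fact ext_injE (x : g3) : ext_inj x = (x, 0 : R^o).
Proof. by rewrite lfunE. Qed.

Definition in_g3 (v : ext1) : bool := v \in limg ext_inj.

Definition generating_plane (p : {vspace ext1}) : Prop :=
  \dim p = 2%N /\ generating p.

Definition case_i (e1 e2 : ext1) : Prop :=
  [/\ in_g3 e1, ~~ in_g3 e2 & killing (ext_proj e1) (ext_proj e2) = 0].

Definition case_ii (e1 e2 : ext1) : Prop :=
  [/\ ~~ in_g3 e1, in_g3 e2,
      isotropic (ext_proj e1) & isotropic (ext_proj e2)].

Definition adapted_basis (p : {vspace ext1}) (e1 e2 : ext1) : Prop :=
  basis_of p [:: e1; e2] /\ (case_i e1 e2 \/ case_ii e1 e2).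

Definition frame (e1 e2 : ext1) : 4.-tuple ext1 :=
  let e3 := [< e1, e2 >] in [tuple e1; e2; e3; [< e1, e3 >]].

Definition nonzero_multiple (v w : ext1) : Prop :=
  exists2 c : R, c != 0 & v = c *: w.

(* C23 k stands for C_23^k, with k counted from 1. *)
Definition frame_relations (e1 e2 : ext1) : Prop :=
  let e := frame e1 e2 in
  let C23 k := struct_const e (inord 1) (inord 2) (inord k.-1) in
  [/\ basis_of fullv e,
      C23 4%N = 0,
      case_i e1 e2 ->
        nonzero_multiple [< e2, [< e1, e2 >] >] e1
        /\ [/\ C23 1%N != 0, C23 2%N = 0 & C23 3%N = 0]
    & case_ii e1 e2 ->
        nonzero_multiple [< e2, [< e1, e2 >] >] e2
        /\ [/\ C23 2%N != 0, C23 1%N = 0 & C23 3%N = 0]].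

End Extension.

(* Main.v *)
(* The bracket of a simple three-dimensional Lie algebra is A (x * y) in
   coordinates, where * is the cross product and A is symmetric and invertible;
   hence the Killing form k is nondegenerate and invariant, and it determines
   double brackets: 2 [x, [y, z]] = k(x, y) z - k(x, z) y. A plane outside g_3
   with two-dimensional projection is spanned by (x, 0) and (y, t) with t <> 0.
   If the Gram determinant of (x, y) is nonzero, the identity shows that brackets
   of these vectors span g; if a vector z of the projection is orthogonal to it,
   the orthogonal complement of z is a subalgebra, so the plane does not
   generate. Moreover x, y and [x, y] then form a basis of g_3 whose structure
   constants depend only on the Gram matrix of (x, y), so planes with the same
   Gram matrix are equivalent; conversely the signs of k(x, x) and of the Gram
   determinant are invariants, since automorphisms of g preserve k. *)
From HB Require Import structures.
Require Import Defs.
From mathcomp Require Import all_boot all_order all_algebra reals.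
From mathcomp Require Import ring lra.

Set Implicit Arguments.
Unset Strict Implicit.
Unset Printing Implicit Defensive.

Import Order.TTheory GRing.Theory Num.Theory.
Local Open Scope ring_scope.

(** * Coordinates, spans and free families of vectors *)

Lemma coord_ext (F : fieldType) (V : vectType F) (u v : V) :
  (forall i, coord (vbasis {:V}) i u = coord (vbasis {:V}) i v) -> u = v.
Proof.
move=> uv; rewrite (coord_vbasis (memvf u)) (coord_vbasis (memvf v)).
by apply: eq_bigr => i _; rewrite uv.
Qed.

(** Comparing coordinates in a fixed basis turns a vector identity into a scalar one, within reach
    of [ring] or [field]. *)
Ltac vec_ring :=
  apply: coord_ext => ?;
  rewrite ?(linearD, linearN, linearZ, linear0, scaler0) /=; ring.

Ltac vec_field :=
  apply: coord_ext => ?;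
  rewrite ?(linearD, linearN, linearZ, linear0, scaler0) /=; field.

Section VectorLemmas.
Variables (F : fieldType) (V : vectType F).
Implicit Types u v w x y z : V.

Lemma span2P u v w :
  reflect (exists a b : F, w = a *: u + b *: v) (w \in <<[:: u; v]>>%VS).
Proof.
rewrite span_cons span_seq1; apply: (iffP memv_addP).
  by case=> _ /vlineP[a ->] [_ /vlineP[b ->] ->]; exists a, b.
case=> a [b ->]; exists (a *: u); first by rewrite memvZ ?memv_line.
by exists (b *: v); rewrite // memvZ ?memv_line.
Qed.

Lemma span3P x y z w :
  reflect (exists a b c : F, w = a *: x + b *: y + c *: z)
    (w \in <<[:: x; y; z]>>%VS).
Proof.
rewrite span_cons; apply: (iffP memv_addP).
  by case=> _ /vlineP[a ->] [_ /span2P[b [c ->]] ->]; exists a, b, c; rewrite addrA.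
case=> a [b [c ->]]; exists (a *: x); first by rewrite memvZ ?memv_line.
by exists (b *: y + c *: z); rewrite ?addrA //; apply/span2P; exists b, c.
Qed.

Lemma free2P x y :
  reflect (forall a b : F, a *: x + b *: y = 0 -> a = 0 /\ b = 0)
    (free [:: x; y]).
Proof.
apply: (iffP (@freeP _ _ _ [tuple x; y])) => [f a b ab0 | f k k0].
  pose k (i : 'I_2) := nth 0 [:: a; b] i.
  have k0 : \sum_(i < 2) k i *: [tuple x; y]`_i = 0.
    by rewrite !big_ord_recl big_ord0 /k /= addr0.
  by have := f k k0; move=> h; split; [have := h ord0 | have := h ord_max].
move: k0; rewrite !big_ord_recl big_ord0 /= addr0 => /f[k0 k1].
by case=> [[|[|//]] i]; [rewrite -[RHS]k0 | rewrite -[RHS]k1]; congr k; apply: val_inj.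
Qed.

Lemma free3P x y z :
  reflect (forall a b c : F, a *: x + b *: y + c *: z = 0 ->
             [/\ a = 0, b = 0 & c = 0])
    (free [:: x; y; z]).
Proof.
apply: (iffP (@freeP _ _ _ [tuple x; y; z])) => [f a b c ab0 | f k k0].
  pose k (i : 'I_3) := nth 0 [:: a; b; c] i.
  have k0 : \sum_(i < 3) k i *: [tuple x; y; z]`_i = 0.
    by rewrite !big_ord_recl big_ord0 /k /= addr0 addrA.
  have h := f k k0; split;
    [have := h (inord 0)| have := h (inord 1)| have := h (inord 2)];
    by rewrite /k inordK.
move: k0; rewrite !big_ord_recl big_ord0 /= addr0 addrA => /f[k0 k1 k2].
by case=> [[|[|[|//]]] i]; [rewrite -[RHS]k0 | rewrite -[RHS]k1 | rewrite -[RHS]k2];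
  congr k; apply: val_inj.
Qed.

Lemma free4P x y z w :
  reflect (forall a b c d : F, a *: x + b *: y + c *: z + d *: w = 0 ->
             [/\ a = 0, b = 0, c = 0 & d = 0])
    (free [:: x; y; z; w]).
Proof.
apply: (iffP (@freeP _ _ _ [tuple x; y; z; w])) => [f a b c d ab0 | f k k0].
  pose k (i : 'I_4) := nth 0 [:: a; b; c; d] i.
  have k0 : \sum_(i < 4) k i *: [tuple x; y; z; w]`_i = 0.
    by rewrite !big_ord_recl big_ord0 /k /= addr0 !addrA.
  have h := f k k0; split;
    [have := h (inord 0)| have := h (inord 1)| have := h (inord 2)| have := h (inord 3)];
    by rewrite /k inordK.
move: k0; rewrite !big_ord_recl big_ord0 /= addr0 !addrA => /f[k0 k1 k2 k3].
by case=> [[|[|[|[|//]]]] i];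
  [rewrite -[RHS]k0 | rewrite -[RHS]k1 | rewrite -[RHS]k2 | rewrite -[RHS]k3];
  congr k; apply: val_inj.
Qed.

End VectorLemmas.

(** * Bracket calculus and consequences of simplicity *)

Section LieBracket.
Variables (F : fieldType) (L : lieAlgType F).
Implicit Types x y z u v w : L.

Lemma bracketDr x y z : [< x, y + z >] = [< x, y >] + [< x, z >].
Proof. exact: linearD. Qed.

Lemma bracketZr a x y : [< x, a *: y >] = a *: [< x, y >].
Proof. exact: linearZ. Qed.

Lemma bracketDl x y z : [< x + y, z >] = [< x, z >] + [< y, z >].
Proof. by have := bracket_linearl z 1 x y; rewrite /= !scale1r. Qed.

Lemma bracket0l y : [< 0, y >] = 0.
Proof. by apply: (addIr [< 0, y >]); rewrite -bracketDl !add0r. Qed.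

Lemma bracketZl a x y : [< a *: x, y >] = a *: [< x, y >].
Proof. by have := bracket_linearl y a x 0; rewrite /= bracket0l !addr0. Qed.

Lemma bracketC x y : [< x, y >] = - [< y, x >].
Proof.
apply/eqP; rewrite -addr_eq0; have := bracketxx (x + y).
by rewrite bracketDl !bracketDr !bracketxx addr0 add0r => /eqP.
Qed.

Lemma bracket0r x : [< x, 0 >] = 0.
Proof. exact: linear0. Qed.

Lemma bracketNr x y : [< x, - y >] = - [< x, y >].
Proof. exact: linearN. Qed.

Lemma bracket_span3 x y z a b c a' b' c' :
  [< a *: x + b *: y + c *: z, a' *: x + b' *: y + c' *: z >]
  = (a * b' - b * a') *: [< x, y >] + (a * c' - c * a') *: [< x, z >]
    + (b * c' - c * b') *: [< y, z >].
Proof.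
rewrite !(bracketDl, bracketDr, bracketZl, bracketZr, bracketxx).
rewrite (bracketC y x) (bracketC z x) (bracketC z y).
vec_ring.
Qed.

Lemma lfun_traceE (f : 'End(L)) :
  lfun_trace f = \sum_i coord (vbasis {:L}) i (f (vbasis {:L})`_i).
Proof.
rewrite /lfun_trace /mxtrace; apply: eq_bigr => i _.
by rewrite /passmx.mxof mxE /= passmx.vecof_delta mxE.
Qed.

Hypothesis simpleL : simple_lie L.

(** Such a [W] is an ideal, and it is nonzero because some bracket is. This lets linear conditions
    be checked on brackets only. *)
Lemma simple_perfect (W : {vspace L}) :
  (forall x y, [< x, y >] \in W) -> W = fullv.
Proof.
move=> WL; case: simpleL => -[x [y xy]] /(_ W)[] //.
  by move=> W0; have := WL x y; rewrite W0 memv0 (negPf xy).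
Qed.

(** The line through a central vector is an ideal, and it cannot be everything for dimension
    reasons. *)
Lemma simple_center x : \dim {:L} != 1%N -> (forall y, [< x, y >] = 0) -> x = 0.
Proof.
move=> dimL xc; case: simpleL => _ /(_ <[x]>%VS)[].
- by move=> u _ /vlineP[a ->]; rewrite bracketZr bracketC xc oppr0 scaler0 mem0v.
- by move=> x0; apply/eqP; rewrite -memv0 -x0 memv_line.
- move=> xL; apply/eqP/contraT => x0.
  by move: dimL; rewrite -xL dim_vline x0.
Qed.

End LieBracket.

(** * Three-dimensional simple Lie algebras in coordinates *)

Section Simple3.
Variables (F : fieldType) (L : lieAlgType F).
Hypotheses (dimL : \dim {:L} = 3%N) (simpleL : simple_lie L).
Implicit Types x y z u v w : L.

(* A is symmetric because the Jacobi identity is a linear relation between the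
   brackets of basis vectors, which are free since [L, L] = L. *)
Lemma simple3_coordinates :
  exists (e : 3.-tuple L) (A : nat -> nat -> F),
  [/\ basis_of {:L} e,
      forall f : 'End(L), lfun_trace f = \sum_i coord e i (f e`_i),
      forall i j, A i j = A j i &
      forall (x y : L) (k : 'I_3),
        let c v j := coord e (inord j) v in
        coord e k [< x, y >]
        = A k 0%N * (c x 1%N * c y 2%N - c x 2%N * c y 1%N)
          + A k 1%N * (c x 2%N * c y 0%N - c x 0%N * c y 2%N)
          + A k 2%N * (c x 0%N * c y 1%N - c x 1%N * c y 0%N)].
Proof.
have [e [eB eT]] : exists e : 3.-tuple L, basis_of {:L} e /\
    forall f : 'End(L), lfun_trace f = \sum_i coord e i (f e`_i).
  have := @lfun_traceE F L; move: (vbasis _) (vbasisP {:L}); rewrite dimL.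
  by move=> e eB eT; exists e.
pose c (v : L) (j : nat) := coord e (inord j) v.
pose s (j : nat) := e`_j.
have cE v : v = c v 0%N *: s 0%N + c v 1%N *: s 1%N + c v 2%N *: s 2%N.
  rewrite {1}(coord_basis eB (memvf v)) !big_ord_recl big_ord0 addr0 addrA.
  have cv (i : 'I_3) : coord e i v = c v i by rewrite /c inord_val.
  by rewrite !cv.
(* Listing the brackets of basis vectors in cyclic order makes the coefficients of a general bracket
   those of a cross product. *)
pose b j : L := [:: [< s 1%N, s 2%N >]; [< s 2%N, s 0%N >]; [< s 0%N, s 1%N >]]`_j.
have bE x y : [< x, y >] = (c x 1%N * c y 2%N - c x 2%N * c y 1%N) *: b 0%N
     + (c x 2%N * c y 0%N - c x 0%N * c y 2%N) *: b 1%N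
     + (c x 0%N * c y 1%N - c x 1%N * c y 0%N) *: b 2%N.
  rewrite {1}(cE x) {1}(cE y) bracket_span3 /b /=.
  by rewrite (bracketC (s 2%N) (s 0%N)); vec_ring.
have bF : free [:: b 0%N; b 1%N; b 2%N].
  have bL : <<[:: b 0%N; b 1%N; b 2%N]>>%VS = fullv.
    apply: (simple_perfect simpleL) => x y; apply/span3P.
    by rewrite bE; do 3!eexists.
  by rewrite /free bL dimL.
have Jac : (c (b 1%N) 0%N - c (b 0%N) 1%N) *: b 2%N
    + (c (b 0%N) 2%N - c (b 2%N) 0%N) *: b 1%N
    + (c (b 2%N) 1%N - c (b 1%N) 2%N) *: b 0%N = 0.
  have := bracket_jacobi (s 0%N) (s 1%N) (s 2%N).
  rewrite -[[< s 1%N, _ >]]/(b 0%N) -[[< s 2%N, s 0%N >]]/(b 1%N).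
  rewrite -[[< s 0%N, s 1%N >]]/(b 2%N) {1}(cE (b 0%N)) {1}(cE (b 1%N)) {1}(cE (b 2%N)).
  rewrite !(bracketDr, bracketZr, bracketxx).
  rewrite (bracketC (s 0%N) (s 2%N)) (bracketC (s 1%N) (s 0%N)) (bracketC (s 2%N) (s 1%N)).
  rewrite -[[< s 1%N, _ >]]/(b 0%N) -[[< s 2%N, s 0%N >]]/(b 1%N).
  rewrite -[[< s 0%N, s 1%N >]]/(b 2%N) => E.
  apply: oppr_inj; rewrite oppr0 -E; vec_ring.
have [A01 A02 A12] : [/\ c (b 0%N) 1%N = c (b 1%N) 0%N,
    c (b 2%N) 0%N = c (b 0%N) 2%N & c (b 1%N) 2%N = c (b 2%N) 1%N].
  have /free3P := bF.
  move=> /(_ (c (b 2%N) 1%N - c (b 1%N) 2%N) (c (b 0%N) 2%N - c (b 2%N) 0%N)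
            (c (b 1%N) 0%N - c (b 0%N) 1%N))[].
    by rewrite -[RHS]Jac; vec_ring.
  by move=> /subr0_eq -> /subr0_eq -> /subr0_eq ->.
(* [inord] sends out-of-range indices to 0, so the guard is what makes [A] symmetric on all natural
   numbers. *)
pose A i j := if (i < 3)%N && (j < 3)%N then c (b j) i else 0.
exists e, A; split=> //.
  move=> [|[|[|i]]] [|[|[|j]]] //=; rewrite /A ?andbF //=.
move=> x y k c'; rewrite bE !linearD !linearZ /= /A ltn_ord /= /c inord_val /c' /=.
ring.
Qed.

(** In the coordinates above, every claim becomes a polynomial identity in the entries of the
    symmetric matrix [A] and the coordinates of the vectors. *)
Lemma killing_simple3 :
  [/\ forall x y, killing x y = killing y x,
      forall a x y z, killing (a *: x + y) z = a * killing x z + killing y z,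
      forall x y z, killing [< x, y >] z = killing x [< y, z >] &
      forall x y z, 2 *: [< x, [< y, z >] >]
        = killing x y *: z - killing x z *: y].
Proof.
have [e [A [eB eT As cb]]] := simple3_coordinates.
pose c (v : L) (j : nat) := coord e (inord j) v.
have cE (k : 'I_3) v : coord e k v = c v k by rewrite /c inord_val.
have cs i j : (i < 3)%N -> (j < 3)%N -> c e`_i j = (i == j)%:R.
  move=> i3 j3; have := coord_free (inord i) (inord j) (basis_free eB).
  by rewrite /c inordK // => ->; congr (_ %:R); rewrite -val_eqE /= !inordK.
have cB x y k : (k < 3)%N -> c [< x, y >] k =
   A k 0%N * (c x 1%N * c y 2%N - c x 2%N * c y 1%N)
          + A k 1%N * (c x 2%N * c y 0%N - c x 0%N * c y 2%N)
          + A k 2%N * (c x 0%N * c y 1%N - c x 1%N * c y 0%N).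
  by move=> k3; rewrite /c cb inordK.
have kE x y : killing x y = c [< x, [< y, e`_0 >] >] 0%N
   + c [< x, [< y, e`_1 >] >] 1%N + c [< x, [< y, e`_2 >] >] 2%N.
  rewrite /killing eT !big_ord_recl big_ord0 addr0 addrA.
  by rewrite !comp_lfunE !adE !cE.
(* The matrix of the Killing form is -2 times the adjugate of [A]. *)
have {kE} kE x y : killing x y = - 2 *
   ((A 1%N 1%N * A 2%N 2%N - A 1%N 2%N ^+ 2) * (c x 0%N * c y 0%N)
   + (A 0%N 0%N * A 2%N 2%N - A 0%N 2%N ^+ 2) * (c x 1%N * c y 1%N)
   + (A 0%N 0%N * A 1%N 1%N - A 0%N 1%N ^+ 2) * (c x 2%N * c y 2%N)
   + (A 0%N 2%N * A 1%N 2%N - A 0%N 1%N * A 2%N 2%N) * (c x 0%N * c y 1%N + c x 1%N * c y 0%N)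
   + (A 0%N 1%N * A 1%N 2%N - A 0%N 2%N * A 1%N 1%N) * (c x 0%N * c y 2%N + c x 2%N * c y 0%N)
   + (A 0%N 1%N * A 0%N 2%N - A 1%N 2%N * A 0%N 0%N) * (c x 1%N * c y 2%N + c x 2%N * c y 1%N)).
  rewrite kE !cB // !cs //= (As 1 0)%N (As 2 0)%N (As 2 1)%N; ring.
have cP a x y k : c (a *: x + y) k = a * c x k + c y k by rewrite /c linearP.
split=> [x y|a x y z|x y z|x y z].
- by rewrite !kE; ring.
- by rewrite !kE !cP; ring.
- by rewrite !kE !cB // (As 1 0)%N (As 2 0)%N (As 2 1)%N; ring.
rewrite (coord_basis eB (memvf (_ *: _))) (coord_basis eB (memvf (_ - _))).
apply: eq_bigr => i _; congr (_ *: _); rewrite linearZ linearB !linearZ /= !cE.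
rewrite !kE; case: i => [[|[|[|//]]] i] /=;
  by rewrite !cB // (As 1 0)%N (As 2 0)%N (As 2 1)%N; ring.
Qed.

End Simple3.

(** * The Killing form, Gram determinants and orthogonality *)

Section Killing.
Variables (R : realType) (L : lieAlgType R).
Hypotheses (dimL : \dim {:L} = 3%N) (simpleL : simple_lie L).
Implicit Types x y z u v w : L.

Lemma killingC x y : killing x y = killing y x.
Proof. by have [] := killing_simple3 dimL simpleL. Qed.

Lemma killing_lin a x y z : killing (a *: x + y) z = a * killing x z + killing y z.
Proof. by have [] := killing_simple3 dimL simpleL. Qed.

Lemma killing_inv x y z : killing [< x, y >] z = killing x [< y, z >].
Proof. by have [] := killing_simple3 dimL simpleL. Qed.

Lemma bracket_bracket x y z :
  [< x, [< y, z >] >] = (killing x y / 2) *: z - (killing x z / 2) *: y.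
Proof.
have n2 : (2 : R) != 0 by rewrite pnatr_eq0.
apply: (scalerI n2); have [_ _ _ ->] := killing_simple3 dimL simpleL.
by rewrite scalerBr !scalerA; congr (_ *: _ - _ *: _); field.
Qed.

Lemma killingDl x y z : killing (x + y) z = killing x z + killing y z.
Proof. by have := killing_lin 1 x y z; rewrite scale1r mul1r. Qed.

Lemma killing0l x : killing 0 x = 0.
Proof. by have := killing_lin (-1) x x x; rewrite scaleN1r addNr => ->; ring. Qed.

Lemma killingZl a x y : killing (a *: x) y = a * killing x y.
Proof. by have := killing_lin a x 0 y; rewrite killing0l !addr0. Qed.

Lemma killingNl x y : killing (- x) y = - killing x y.
Proof. by rewrite -scaleN1r killingZl mulN1r. Qed.

Lemma killingDr x y z : killing x (y + z) = killing x y + killing x z.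
Proof. by rewrite !(killingC x) killingDl. Qed.

Lemma killingZr a x y : killing x (a *: y) = a * killing x y.
Proof. by rewrite !(killingC x) killingZl. Qed.

Lemma killingNr x y : killing x (- y) = - killing x y.
Proof. by rewrite !(killingC x) killingNl. Qed.

Definition killingE :=
  (killingDl, killingZl, killingNl, killingDr, killingZr, killingNr).

(** By [bracket_bracket], a vector in the radical of the form commutes with all brackets, hence is
    central. *)
Lemma killing_nondeg x : (forall y, killing x y = 0) -> x = 0.
Proof.
move=> x0; apply: (simple_center simpleL); first by rewrite dimL.
suff W y : y \in lker (ad x) by move=> y; apply/eqP; rewrite -adE -memv_ker.
suff -> : lker (ad x) = fullv by rewrite memvf.
apply: (simple_perfect simpleL) => u v.
by rewrite memv_ker adE bracket_bracket !x0 mul0r !scale0r subrr.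
Qed.

Lemma killing_pairing x : x != 0 -> exists y, killing x y != 0.
Proof.
move=> x0; have [i ki|k0] := pickP (fun i : 'I_(\dim {:L}) => killing x (vbasis {:L})`_i != 0).
  by exists (vbasis {:L})`_i.
case/eqP: x0; apply: killing_nondeg => y; rewrite (coord_vbasis (memvf y)).
elim/big_rec: _ => [|i z _ z0]; first by rewrite killingC killing0l.
by rewrite !killingE z0; have /negbFE/eqP -> := k0 i; rewrite mulr0 addr0.
Qed.

Lemma killing_bracketl x y : killing x [< x, y >] = 0.
Proof. by rewrite -killing_inv bracketxx killing0l. Qed.

Lemma killing_bracketr x y : killing y [< x, y >] = 0.
Proof. by rewrite bracketC killingNr killing_bracketl oppr0. Qed.

Definition gram x y : R := killing x x * killing y y - killing x y ^+ 2.

Lemma killing_bracket2 x y : killing [< x, y >] [< x, y >] = - gram x y / 2.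
Proof.
by rewrite killing_inv bracket_bracket !killingE (killingC y x) /gram; field.
Qed.

(** Since [[< x, y >]] is orthogonal to [x] and [y], pairing a relation with the three vectors
    isolates [c], with factor [- gram x y / 2], and leaves a linear system in [a], [b] of
    determinant [gram x y], solved by Cramer's rule. *)
Lemma gram_free3 x y : gram x y != 0 -> free [:: x; y; [< x, y >]].
Proof.
move=> D0; apply/free3P => a b c E.
have kE u : a * killing u x + b * killing u y + c * killing u [< x, y >] = 0.
  by rewrite -!killingZr -!killingDr E killingC killing0l.
have := kE x; rewrite killing_bracketl mulr0 addr0 => Ex.
have := kE y; rewrite killing_bracketr mulr0 addr0 (killingC y x) => Ey.
have := kE [< x, y >]; rewrite killing_bracket2 !(killingC [< x, y >]).
rewrite killing_bracketl killing_bracketr !mulr0 !add0r => Ez.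
split; apply: (mulIf D0); rewrite mul0r.
- rewrite /gram.
  transitivity (killing y y * (a * killing x x + b * killing x y)
    - killing x y * (a * killing x y + b * killing y y)); first by ring.
  by rewrite Ex Ey; ring.
- rewrite /gram.
  transitivity (killing x x * (a * killing x y + b * killing y y)
    - killing x y * (a * killing x x + b * killing x y)); first by ring.
  by rewrite Ex Ey; ring.
- transitivity ((-2) * (c * (- gram x y / 2))); first by field.
  by rewrite Ez mulr0.
Qed.

Lemma gram_span3 x y u : gram x y != 0 ->
  exists a b c, u = a *: x + b *: y + c *: [< x, y >].
Proof.
move=> /gram_free3 f; apply/span3P; suff -> : <<[:: x; y; [< x, y >]]>>%VS = fullv.
  exact: memvf.
by apply/eqP; rewrite eqEdim subvf dimL (eqnP f).
Qed.

(** For [z] not orthogonal to [x], the expansion of [[< z, [< x, y >] >] = 0] is a relation between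
    [x] and [y] in which [y] has a nonzero coefficient. *)
Lemma centralizer_line x y : x != 0 -> [< x, y >] = 0 -> exists a, y = a *: x.
Proof.
move=> /killing_pairing[z zx] xy; exists (killing z y / killing z x).
have := bracket_bracket z x y; rewrite xy bracket0r => /esym/eqP.
rewrite subr_eq0 => /eqP E; rewrite killingC in zx.
apply: (@scalerI _ _ (killing z x / 2)); first by rewrite mulf_neq0 ?invr_neq0 ?pnatr_eq0.
by rewrite E scalerA; congr (_ *: _); field.
Qed.

(** By [bracket_bracket], [x] commutes with [[< u, v >]], which is therefore a multiple of the
    isotropic [x]. Thus the orthogonal complement of an isotropic vector is a subalgebra. *)
Lemma isotropic_perp_bracket x u v : killing x x = 0 ->
  killing x u = 0 -> killing x v = 0 -> killing x [< u, v >] = 0.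
Proof.
move=> xx xu xv; have [->|x0] := eqVneq x 0; first exact: killing0l.
have [|a ->] := @centralizer_line x [< u, v >] x0; last by rewrite killingZr xx mulr0.
by rewrite bracket_bracket xu xv mul0r !scale0r subrr.
Qed.

(** Orthogonal pairs give case (i) and isotropic pairs case (ii); in both, [x] is the vector that
    lifts into [g3]. *)
Definition orthogonal_pair x y :=
  [/\ killing x y = 0, killing x x != 0 & killing y y != 0].

Definition isotropic_pair x y :=
  [/\ killing x x = 0, killing y y = 0 & killing x y != 0].

Lemma gram_orthogonal x y : orthogonal_pair x y -> gram x y != 0.
Proof. by case=> xy xx yy; rewrite /gram xy expr0n subr0 mulf_neq0. Qed.

Lemma gram_isotropic x y : isotropic_pair x y -> gram x y != 0.
Proof. by case=> xx yy xy; rewrite /gram xx mul0r sub0r oppr_eq0 expf_neq0. Qed.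

(** Only [y] is moved, because the line of [x] is fixed by the plane. If [x] is not isotropic this
    is a Gram-Schmidt step; otherwise [m] solves the equation
    [killing y y + 2 * m * killing x y = 0], which makes the new vector isotropic. *)
Lemma gram_normalize x y : gram x y != 0 ->
  exists m, orthogonal_pair x (y + m *: x) \/ isotropic_pair x (y + m *: x).
Proof.
move=> D0; have [xx|xx] := eqVneq (killing x x) 0.
  have xy : killing x y != 0.
    by apply: contraNneq D0 => xy; rewrite /gram xx xy expr0n mul0r subrr.
  exists (- killing y y / (2 * killing x y)); right; split=> //.
    by rewrite !killingE xx (killingC y x); field.
  by rewrite killingDr killingZr xx mulr0 addr0.
exists (- killing x y / killing x x); left; split=> //.
  by rewrite !killingE; field.
suff -> : killing (y + (- killing x y / killing x x) *: x)
            (y + (- killing x y / killing x x) *: x) = gram x y / killing x x.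
  by rewrite mulf_neq0 ?invr_neq0.
by rewrite !killingE (killingC y x) /gram; field.
Qed.

(** The vector [killing y y *: x - killing x y *: y] is orthogonal to [y], and its product with [x]
    is the Gram determinant. It vanishes only if [y] is itself orthogonal to [x] and to [y], and
    then [y] serves as [z]. *)
Lemma gram_radical x y : free [:: x; y] -> gram x y = 0 ->
  exists z, [/\ z != 0, z \in <<[:: x; y]>>%VS, killing z x = 0 & killing z y = 0].
Proof.
move=> /free2P f D0.
have [yx|yx] := eqVneq (killing y x) 0; first have [yy|yy] := eqVneq (killing y y) 0.
- exists y; split=> //; last by apply: memv_span; rewrite !inE eqxx orbT.
  apply: contraTneq isT => y0; have [|_ /eqP] := f 0 1.
    by rewrite y0 scaler0 scale0r addr0.
  by rewrite oner_eq0.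
all: exists (killing y y *: x - killing x y *: y); split.
all: try by apply/span2P; exists (killing y y), (- killing x y); rewrite scaleNr.
all: try by rewrite !killingE; ring.
all: try by rewrite !killingE (killingC y x) -[RHS]D0 /gram; ring.
all: apply/negP; rewrite -scaleNr => /eqP /f[].
- by move/eqP: yy.
- by move=> _ /eqP; rewrite oppr_eq0 killingC (negPf yx).
Qed.

(** Merges conditions 2) and 3) of the criterion into one inequality. *)
Lemma gram_nondegenerate x y :
  gram x y != 0 <-> free [:: x; y] /\ killing_nondegenerate_on <<[:: x; y]>>%VS.
Proof.
split=> [D0|[f nd]]; last first.
  apply/negP => /eqP /(gram_radical f)[z [/eqP z0 zxy zx zy]]; apply/z0/nd => //.
  by move=> _ /span2P[a [b ->]]; rewrite !killingE zx zy !mulr0 addr0.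
have f : free [:: x; y].
  apply/free2P => a b ab; have /free3P := gram_free3 D0.
  by move=> /(_ a b 0)[]; rewrite // scale0r addr0.
split=> // _ /span2P[a [b ->]] nd.
have := nd x (memv_span (mem_head _ _)).
have := nd y (memv_span (mem_last x [:: y])).
rewrite !killingE (killingC y x) => ny nx.
have a0 : a = 0.
  apply: (mulIf D0); rewrite mul0r /gram.
  transitivity (killing y y * (a * killing x x + b * killing x y)
    - killing x y * (a * killing x y + b * killing y y)); first by ring.
  by rewrite nx ny !mulr0 subrr.
have b0 : b = 0.
  apply: (mulIf D0); rewrite mul0r /gram.
  transitivity (killing x x * (a * killing x y + b * killing y y)
    - killing x y * (a * killing x x + b * killing x y)); first by ring.
  by rewrite nx ny !mulr0 subrr.
by rewrite a0 b0 !scale0r addr0.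
Qed.

(** An isotropic nonzero vector forms a suitable pair with any vector not orthogonal to it.
    Otherwise take [x] and a nonzero [[< x, y >]], which is orthogonal to [x]. *)
Lemma exists_gram : exists x y, gram x y != 0.
Proof.
have [x x0] : exists x : L, x != 0.
  have [[x [y xy]] _] := simpleL; exists [< x, y >]; exact: xy.
have iso u : u != 0 -> killing u u = 0 -> exists x y, gram x y != 0.
  move=> /killing_pairing[v uv] uu; exists u, v.
  by rewrite /gram uu mul0r sub0r oppr_eq0 expf_neq0.
have [/(iso _ x0) //|xx] := eqVneq (killing x x) 0.
have [y xy] : exists y, [< x, y >] != 0.
  have [i ki|k0] := pickP (fun i : 'I_(\dim {:L}) => [< x, (vbasis {:L})`_i >] != 0).
    by exists (vbasis {:L})`_i.
  case/eqP: x0; apply: (simple_center simpleL); first by rewrite dimL.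
  move=> y; rewrite (coord_vbasis (memvf y)) linear_sum big1 // => i _.
  by rewrite linearZ /=; have /negbFE/eqP -> := k0 i; rewrite scaler0.
have [/(iso _ xy) //|ww] := eqVneq (killing [< x, y >] [< x, y >]) 0.
by exists x, [< x, y >]; rewrite /gram killing_bracketl expr0n subr0 mulf_neq0.
Qed.

End Killing.

(** * Generating planes and the criterion for them *)

Lemma generatingP (F : fieldType) (L : lieAlgType F) (p : {vspace L}) :
  generating p <->
  forall W : {vspace L}, subalgebra W -> (p <= W)%VS -> W = fullv.
Proof.
split=> [[_ _ pW] W WL /(pW W WL) sW|pW]; first by apply/eqP; rewrite eqEsubv subvf.
by split=> [x y _ _||W WL /(pW W WL) ->]; rewrite ?memvf ?subvf.
Qed.

Lemma span2_scale (F : fieldType) (V : vectType F) (u v : V) (a b c : F) :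
  a != 0 -> b != 0 -> span [:: a *: u; b *: v + c *: u] = span [:: u; v].
Proof.
move=> a0 b0; apply/eqP; rewrite eqEsubv; apply/andP; split; apply/span_subvP => w;
  rewrite !inE => /orP[] /eqP ->; apply/span2P.
- by exists a, 0; rewrite scale0r addr0.
- by exists c, b; rewrite addrC.
- by exists a^-1, 0; rewrite scale0r addr0 scalerA mulVf ?scale1r.
- by exists (- (b^-1 * c * a^-1)), b^-1; vec_field; rewrite b0.
Qed.

Lemma span2C (F : fieldType) (V : vectType F) (u v : V) :
  span [:: u; v] = span [:: v; u].
Proof. by apply: eq_span => w; rewrite !inE orbC. Qed.

Section Planes.
Variables (R : realType) (L : lieAlgType R).
Hypotheses (dimL : \dim {:L} = 3%N) (simpleL : simple_lie L).
Implicit Types (x y z : L) (u v : ext1 L) (s t : R).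

Definition ext_pair x t : ext1 L := (x, t : R^o).

Lemma ext_pairZ a x t : a *: ext_pair x t = ext_pair (a *: x) (a * t).
Proof. by []. Qed.

Lemma ext_pairD x t y s : ext_pair x t + ext_pair y s = ext_pair (x + y) (t + s).
Proof. by []. Qed.

Lemma ext_eq u v : u.1 = v.1 -> u.2 = v.2 -> u = v.
Proof. by case: u v => [? ?] [? ?] /= -> ->. Qed.

Lemma ext_bracketE u v : [< u, v >] = ext_pair [< u.1, v.1 >] 0.
Proof. by []. Qed.

Lemma ext_pair_eta u : u = ext_pair u.1 u.2.
Proof. by case: u. Qed.

Lemma ext_pair_eq0 x t : ext_pair x t = 0 -> x = 0 /\ t = 0.
Proof. by case. Qed.

Lemma dim_ext : \dim {:ext1 L} = 4%N.
Proof.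
have := dimL; rewrite !dimvf => d.
by rewrite -[RHS]/(3 + 1)%N -d.
Qed.

Lemma in_g3E u : in_g3 u = (u.2 == 0).
Proof.
apply/idP/eqP => [/memv_imgP[x _ ->]|u2]; first by rewrite ext_injE.
by apply/memv_imgP; exists u.1; rewrite ?memvf // ext_injE [u]ext_pair_eta u2.
Qed.

(** For independent [x], [y], the graph of the linear form on their span that vanishes at [x] and
    equals [t] at [y]. *)
Definition graph_plane x y t : {vspace ext1 L} :=
  <<[:: ext_pair x 0; ext_pair y t]>>%VS.

Lemma graph_plane_scale x y t a b c : a != 0 -> b != 0 ->
  graph_plane (a *: x) (b *: y + c *: x) (b * t) = graph_plane x y t.
Proof.
move=> a0 b0; rewrite -[RHS](span2_scale (ext_pair x 0) (ext_pair y t) c a0 b0).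
by rewrite !ext_pairZ ext_pairD !mulr0 addr0.
Qed.

Lemma graph_plane_proj x y t : (ext_proj L @: graph_plane x y t)%VS = <<[:: x; y]>>%VS.
Proof. by rewrite limg_span /= !ext_projE. Qed.

Lemma graph_plane_free x y t : gram x y != 0 ->
  free [:: ext_pair x 0; ext_pair y t].
Proof.
move=> /(gram_free3 dimL simpleL)/free3P f; apply/free2P => a b.
rewrite !ext_pairZ ext_pairD => /ext_pair_eq0[ab _].
by have [] := f a b 0; rewrite // scale0r addr0.
Qed.

Lemma graph_plane_generating x y t : gram x y != 0 -> t != 0 ->
  generating_plane (graph_plane x y t).
Proof.
move=> D0 t0; split; first exact: (eqnP (graph_plane_free t D0)).
apply/generatingP => W WL /span_subvP pW.
have W1 : ext_pair x 0 \in W by apply: pW; rewrite !inE eqxx.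
have W2 : ext_pair y t \in W by apply: pW; rewrite !inE eqxx orbT.
have W3 : ext_pair [< x, y >] 0 \in W by apply: (WL _ _ W1 W2).
have W4 : ext_pair [< x, [< x, y >] >] 0 \in W by apply: (WL _ _ W1 W3).
have W5 : ext_pair [< y, [< x, y >] >] 0 \in W by apply: (WL _ _ W2 W3).
(* Eliminating [x] between the two double brackets leaves [gram x y / 2] times [y], now with zero
   second component. *)
have W6 : ext_pair y 0 \in W.
  suff -> : ext_pair y 0 = (2 / gram x y) *:
      (killing y y *: ext_pair [< x, [< x, y >] >] 0
       - killing x y *: ext_pair [< y, [< x, y >] >] 0).
    by rewrite rpredZ // rpredB ?rpredZ.
  apply: ext_eq => /=; last by rewrite !scaler0 subr0 scaler0.
  rewrite !bracket_bracket // (killingC dimL simpleL y x).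
  by apply: (scalerI D0); rewrite scalerA mulrCA divff // mulr1 /gram; vec_field.
have W7 : ext_pair 0 1 \in W.
  suff -> : ext_pair 0 1 = t^-1 *: (ext_pair y t - ext_pair y 0).
    by rewrite rpredZ // rpredB.
  by apply: ext_eq; rewrite /= ?subrr ?scaler0 // subr0 [_ *: _]mulVf.
apply/eqP; rewrite eqEsubv subvf /=; apply/subvP => u _.
have [a [b [c uE]]] := gram_span3 dimL simpleL u.1 D0.
suff -> : u = a *: ext_pair x 0 + b *: ext_pair y 0 + c *: ext_pair [< x, y >] 0
   + u.2 *: ext_pair 0 1 by rewrite !rpredD // rpredZ.
by apply: ext_eq; rewrite /= ?scaler0 ?add0r ?addr0 // [_ *: _]mulr1.
Qed.

(** If both basis vectors had zero second component, the plane would equal its projection. So one of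
    them, [v'], does not, and subtracting a multiple of it pushes the other into [g3]. *)
Lemma plane_graph (p : {vspace ext1 L}) : \dim p = 2%N ->
  (ext_inj L @: (ext_proj L @: p))%VS <> p ->
  exists x y t, t != 0 /\ p = graph_plane x y t.
Proof.
move=> dimp pN; have := vbasisP p; have := size_tuple (vbasis p).
case: (tval (vbasis p)) => [|u [|v [|? ?]]] /=; rewrite dimp // => _ /span_basis pE.
have key u' v' : <<[:: u'; v']>>%VS = p -> v'.2 != 0 ->
    exists x y t, t != 0 /\ p = graph_plane x y t.
  move=> pE' v0; exists (u'.1 - (u'.2 / v'.2) *: v'.1), v'.1, v'.2; split=> //.
  rewrite -pE' span2C -(span2_scale v' u' (- (u'.2 / v'.2)) (oner_neq0 R) (oner_neq0 R)).
  rewrite span2C /graph_plane !scale1r scaleNr; congr (span [:: _; _]).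
    by apply: ext_eq; rewrite //= [_ *: v'.2]divfK // subrr.
  exact: ext_pair_eta.
have [v0|] := eqVneq v.2 0; last exact: (key u v).
have [u0|u0] := eqVneq u.2 0.
  case: pN; rewrite -pE !limg_span /= !ext_projE !ext_injE.
  by rewrite [u in RHS]ext_pair_eta [v in RHS]ext_pair_eta u0 v0.
by apply: (key v u) => //; rewrite -pE span2C.
Qed.

(** The projection is a homomorphism, so the preimage of a subalgebra is a subalgebra, here one
    containing [p]. *)
Lemma generating_proj (p : {vspace ext1 L}) (U : {vspace L}) : generating p ->
  subalgebra U -> (ext_proj L @: p <= U)%VS -> U = fullv.
Proof.
move=> /generatingP gp UL pU; have W : (ext_proj L @^-1: U)%VS = fullv.
  apply: gp; first by move=> u v; rewrite -!memv_preim !ext_projE; apply: UL.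
  by apply/subvP => u up; rewrite -memv_preim; apply/(subvP pU)/memv_img.
apply/eqP; rewrite eqEsubv subvf; apply/subvP => x _.
have := memvf (ext_pair x 0); rewrite -W -memv_preim ext_projE; exact.
Qed.

(** Equality would place [p] inside [g3], a subalgebra that misses the vector [(0, 1)]. *)
Lemma generating_not_g3 (p : {vspace ext1 L}) : generating p ->
  (ext_inj L @: (ext_proj L @: p))%VS <> p.
Proof.
move=> /generatingP gp pE.
have W : limg (ext_inj L) = fullv.
  apply: gp; last by rewrite -pE limgS ?subvf.
  by move=> u v _ _; rewrite -[_ \in _]/(in_g3 _) in_g3E.
have := memvf (ext_pair 0 1); rewrite -W -[_ \in _]/(in_g3 _) in_g3E.
by rewrite oner_eq0.
Qed.

Lemma line_subalgebra x : subalgebra <[x]>.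
Proof.
move=> _ _ /vlineP[a ->] /vlineP[b ->].
by rewrite bracketZl bracketZr bracketxx !scaler0 mem0v.
Qed.

(** A zero Gram determinant puts the projection inside a proper subalgebra: a line if [x], [y] are
    dependent, otherwise the orthogonal complement of a vector [z] of their span that is orthogonal
    to the whole span. *)
Lemma generating_gram x y t : generating (graph_plane x y t) -> gram x y != 0.
Proof.
move=> gp; have sxy : (ext_proj L @: graph_plane x y t <= <<[:: x; y]>>)%VS.
  by rewrite graph_plane_proj.
have not_line z : (<<[:: x; y]>> <= <[z]>)%VS -> False.
  move=> /(subv_trans sxy)/(generating_proj gp (@line_subalgebra z)) zE.
  by have := dimL; rewrite -zE dim_vline; case: (_ != 0).
have fxy : free [:: x; y].
  apply/free2P => a b ab; have [a0|a0] := eqVneq a 0.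
    split=> //; apply/eqP/contraT => b0; case: (not_line x).
    move: ab; rewrite a0 scale0r add0r => /eqP; rewrite scaler_eq0 (negPf b0) /= => /eqP ->.
    by rewrite span_cons span_seq1 subv_add subvv sub0v.
  case: (not_line y); rewrite span_cons span_seq1 subv_add subvv andbT -memvE.
  apply/vlineP; exists (- b / a); apply: (scalerI a0).
  have -> : a *: x = - (b *: y) by apply/eqP; rewrite -addr_eq0 ab.
  by vec_field.
apply/negP => /eqP /(gram_radical dimL simpleL fxy)[z [z0 zxy zx zy]].
have klin : linear (killing z : L -> R^o).
  by move=> a u v; rewrite killingDr // killingZr.
(* Packaging [killing z] as a linear form makes the orthogonal complement of [z] available as a
   kernel. *)
pose kM := GRing.isLinear.Build R L R^o _ (killing z) klin.
pose kL : {linear L -> R^o} := HB.pack (killing z : L -> R^o) kM.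
have kerE w : (w \in lker (linfun kL)) = (killing z w == 0).
  by rewrite memv_ker lfunE.
case/eqP: z0; apply: (killing_nondeg dimL simpleL) => w; apply/eqP; rewrite -kerE.
suff -> : lker (linfun kL) = fullv by rewrite memvf.
have kxy (v : L) : v \in <<[:: x; y]>>%VS -> killing z v = 0.
  by move=> /span2P[a [b ->]]; rewrite !killingE // zx zy !mulr0 addr0.
apply: (generating_proj gp) => [u v|].
  rewrite !kerE => /eqP zu /eqP zv.
  by apply/eqP/isotropic_perp_bracket => //; apply: kxy.
by apply/(subv_trans sxy)/subvP => v /kxy zv; rewrite kerE zv.
Qed.

Lemma generating_planeP (p : {vspace ext1 L}) :
  generating_plane p <->
  exists x y t, [/\ t != 0, gram x y != 0 & p = graph_plane x y t].
Proof.
split=> [[dimp gp]|[x [y [t [t0 D0 ->]]]]]; last exact: graph_plane_generating.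
have [x [y [t [t0 pE]]]] := plane_graph dimp (generating_not_g3 gp).
by exists x, y, t; split=> //; move: gp; rewrite pE; apply: generating_gram.
Qed.

Lemma generating_plane_criterion (p : {vspace ext1 L}) : \dim p = 2%N ->
  let p1 := (ext_proj L @: p)%VS in
  generating p <->
  [/\ (ext_inj L @: p1)%VS <> p, \dim p1 = 2%N & killing_nondegenerate_on p1].
Proof.
move=> dimp p1; split=> [gp|[pN dimp1 nd]].
  have pN := generating_not_g3 gp.
  have /generating_planeP[x [y [t [t0 D0 pE]]]] : generating_plane p by [].
  have [/eqnP f nd] := (gram_nondegenerate dimL simpleL x y).1 D0.
  by split; rewrite // /p1 pE graph_plane_proj.
have [x [y [t [t0 pE]]]] := plane_graph dimp pN.
rewrite /p1 pE graph_plane_proj in dimp1 nd *.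
apply: (graph_plane_generating _ t0).2; apply/gram_nondegenerate => //.
by split=> //; rewrite /free dimp1.
Qed.

End Planes.

(** * Adapted bases and their structure constants *)

Section Frames.
Variables (R : realType) (L : lieAlgType R).
Hypotheses (dimL : \dim {:L} = 3%N) (simpleL : simple_lie L).
Implicit Types (x y z u v : L) (s t r : R).

Lemma graph_plane_normal (p : {vspace ext1 L}) : generating_plane p ->
  exists x y t, [/\ t != 0, p = graph_plane x y t
    & orthogonal_pair x y \/ isotropic_pair x y].
Proof.
move=> /(generating_planeP dimL simpleL)[x [y [t [t0 D0 ->]]]].
have [m xym] := gram_normalize dimL simpleL D0.
exists x, (y + m *: x), t; split=> //.
rewrite -(graph_plane_scale x y t m (oner_neq0 R) (oner_neq0 R)).
by rewrite !scale1r mul1r.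
Qed.

(** The [g3]-component of a linear relation gives [c = 0] and expresses [a], [b] through [d]; the
    scalar component is then [d / 2] times the second quantity assumed nonzero. *)
Lemma frame_basis u v s r : gram u v != 0 ->
  killing u v * s - killing u u * r != 0 ->
  basis_of fullv (frame (ext_pair u s) (ext_pair v r)).
Proof.
move=> D0 E0; have /free3P f := gram_free3 dimL simpleL D0.
have f4 : free (frame (ext_pair u s) (ext_pair v r)).
  apply/free4P => a b c d; rewrite !ext_bracketE /= bracket_bracket //.
  rewrite !ext_pairZ !ext_pairD !mulr0 !addr0 => /ext_pair_eq0[/= E1 E2].
  have [] := f (a - d * killing u v / 2) (b + d * killing u u / 2) c.
    by rewrite -[RHS]E1; vec_field.
  move=> /subr0_eq aE /eqP; rewrite addr_eq0 => /eqP bE c0.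
  have d0 : d = 0.
    apply: (mulIf E0); rewrite mul0r; transitivity (2 * (a * s + b * r)).
      by rewrite aE bE; field.
    by rewrite E2 mulr0.
  by split; rewrite ?aE ?bE ?d0 //; field.
by rewrite basisEfree f4 subvf dim_ext // size_tuple.
Qed.

Lemma frame_relationsP u v s r : gram u v != 0 ->
  let e1 := ext_pair u s in let e2 := ext_pair v r in
  case_i e1 e2 \/ case_ii e1 e2 -> frame_relations e1 e2.
Proof.
move=> D0 e1 e2 cs.
have case_iE : case_i e1 e2 -> [/\ s = 0, r != 0, killing u v = 0,
    killing u u != 0 & killing v v != 0].
  case; rewrite !in_g3E !ext_projE /= => /eqP s0 r0 uv.
  by move: D0; rewrite /gram uv expr0n subr0 mulf_eq0 negb_or => /andP[].
have case_iiE : case_ii e1 e2 -> [/\ s != 0, r = 0, killing u u = 0,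
    killing v v = 0 & killing u v != 0].
  case; rewrite !in_g3E /isotropic !ext_projE /= => s0 /eqP r0 uu vv; split=> //.
  by apply: contraNneq D0 => uv; rewrite /gram uu uv expr0n mul0r subrr.
have eB : basis_of fullv (frame e1 e2).
  apply: frame_basis => //; case: cs => [/case_iE[-> r0 -> uu _]|/case_iiE[s0 -> -> _ uv]].
    by rewrite mulr0 sub0r oppr_eq0 mulf_neq0.
  by rewrite mulr0 subr0 mulf_neq0.
(* Positions 1 and 2 of the frame, counted from 0, hold [e2] and [e3]. A bracket equal to [c] times
   one frame vector has all its structure constants determined. *)
have CE c (i : 'I_4) k : (i < 2)%N -> (k < 4)%N ->
    [< e2, [< e1, e2 >] >] = c *: (frame e1 e2)`_i ->
    struct_const (frame e1 e2) (inord 1) (inord 2) (inord k) = c * (val i == k)%:R.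
  move=> i2 k4 E; rewrite /struct_const !inordK //= E linearZ /= coord_free ?(basis_free eB) //.
  by rewrite -val_eqE /= inordK.
(* One of the two terms dies in each case: the first by orthogonality in (i), the second by isotropy
   of [v] in (ii). *)
have e23 : [< e2, [< e1, e2 >] >]
    = ext_pair ((killing u v / 2) *: v - (killing v v / 2) *: u) 0.
  by rewrite !ext_bracketE /= bracket_bracket // (killingC dimL simpleL v u).
have multi : case_i e1 e2 -> [< e2, [< e1, e2 >] >] = (- killing v v / 2) *: e1.
  case/case_iE=> s0 _ uv _ _; rewrite e23 uv /e1 s0 ext_pairZ mulr0; congr ext_pair.
  by vec_field.
have multii : case_ii e1 e2 -> [< e2, [< e1, e2 >] >] = (killing u v / 2) *: e2.
  case/case_iiE=> _ r0 _ vv _; rewrite e23 vv /e2 r0 ext_pairZ mulr0; congr ext_pair.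
  by vec_field.
have c0 (a : R) : a != 0 -> a / 2 != 0 by move=> a0; rewrite mulf_neq0 ?invr_neq0 ?pnatr_eq0.
split=> // [|ci|cii].
- case: cs => [ci|cii]; first by rewrite (CE _ ord0 _ _ _ (multi ci)) //= mulr0.
  by rewrite (CE _ (@Ordinal 4 1 isT) _ _ _ (multii cii)) //= mulr0.
- have [_ _ _ _ vv] := case_iE ci; have c00 : - killing v v / 2 != 0 by rewrite c0 ?oppr_eq0.
  split; first by exists (- killing v v / 2) => //; apply: multi.
  by split; rewrite (CE _ ord0 _ _ _ (multi ci)) //= ?mulr0 ?mulr1.
- have [_ _ _ _ uv] := case_iiE cii; have c00 := c0 _ uv.
  split; first by exists (killing u v / 2) => //; apply: multii.
  by split; rewrite (CE _ (@Ordinal 4 1 isT) _ _ _ (multii cii)) //= ?mulr0 ?mulr1.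
Qed.

Lemma graph_plane_mem x y t (f : ext1 L) : f \in graph_plane x y t ->
  exists a b, f = ext_pair (a *: x + b *: y) (b * t).
Proof.
move=> /span2P[a [b ->]]; exists a, b.
by rewrite !ext_pairZ ext_pairD mulr0 add0r.
Qed.

Lemma adapted_basis_mem (p : {vspace ext1 L}) e1 e2 : adapted_basis p e1 e2 ->
  [/\ e1 \in p, e2 \in p, e1 != 0 & e2 != 0].
Proof.
case=> eB _; split.
- by apply: (basis_mem eB); rewrite mem_head.
- by apply: (basis_mem eB); rewrite !inE eqxx orbT.
- by apply: (free_not0 (basis_free eB)); rewrite mem_head.
- by apply: (free_not0 (basis_free eB)); rewrite !inE eqxx orbT.
Qed.

(** A vector of the plane lying in [g3] is a multiple of [ext_pair x 0]. It is not isotropic unless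
    zero, which excludes case (ii), and orthogonality to it removes the [x]-part of [f2]. *)
Lemma adapted_basis_orthogonal x y t : orthogonal_pair x y -> t != 0 ->
  let p := graph_plane x y t in
  adapted_basis p (ext_pair x 0) (ext_pair y t) /\
  forall f1 f2 : ext1 L, adapted_basis p f1 f2 ->
    exists a b : R, [/\ a != 0, b != 0, f1 = a *: ext_pair x 0 & f2 = b *: ext_pair y t].
Proof.
move=> xyo t0 p; have [xy xx yy] := xyo; have D0 := gram_orthogonal xyo.
split.
  split; first by rewrite /basis_of eqxx (graph_plane_free dimL simpleL).
  by left; split; rewrite ?in_g3E ?ext_projE.
move=> f1 f2 fB.
have [/graph_plane_mem[a1 [b1 E1]] /graph_plane_mem[a2 [b2 E2]]] :=
  adapted_basis_mem fB.
case: fB => _; rewrite /case_i /case_ii !in_g3E /isotropic !ext_projE E1 E2 /=.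
rewrite !mulf_eq0 (negPf t0) !orbF => + f10 f20.
case=> [[/eqP b10 b20]|[b10 /eqP b20 _]].
- move: f10; rewrite b10 scale0r addr0 mul0r => f10.
  have a10 : a1 != 0.
    by apply: contraNneq f10 => ->; rewrite scale0r.
  rewrite !killingE // xy => /eqP; rewrite !mulr0 addr0 !mulf_eq0 (negPf xx) (negPf a10).
  rewrite orbF /= => /eqP a20; exists a1, b2; split=> //.
    by rewrite ext_pairZ mulr0.
  by rewrite a20 scale0r add0r ext_pairZ.
- move: f20; rewrite b20 scale0r addr0 mul0r => f20.
  have a20 : a2 != 0.
    by apply: contraNneq f20 => ->; rewrite scale0r.
  by rewrite !killingE // => /eqP; rewrite !mulf_eq0 (negPf xx) (negPf a20).
Qed.

(** Here case (i) fails because [x] is orthogonal to no vector outside its own line in the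
    projection. In case (ii), [a1 *: x + b1 *: y] with [b1 != 0] is isotropic only if [a1 = 0]. *)
Lemma adapted_basis_isotropic x y t : isotropic_pair x y -> t != 0 ->
  let p := graph_plane x y t in
  adapted_basis p (ext_pair y t) (ext_pair x 0) /\
  forall f1 f2 : ext1 L, adapted_basis p f1 f2 ->
    exists a b : R, [/\ a != 0, b != 0, f1 = a *: ext_pair y t & f2 = b *: ext_pair x 0].
Proof.
move=> xyi t0 p; have [xx yy xy] := xyi; have D0 := gram_isotropic xyi.
split.
  split; last by right; split; rewrite ?in_g3E ?/isotropic ?ext_projE.
  rewrite (@perm_basis _ _ _ [:: ext_pair x 0; ext_pair y t]).
    by rewrite /basis_of eqxx (graph_plane_free dimL simpleL).
  by rewrite (perm_catC [:: _] [:: _]).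
move=> f1 f2 fB.
have [/graph_plane_mem[a1 [b1 E1]] /graph_plane_mem[a2 [b2 E2]]] :=
  adapted_basis_mem fB.
case: fB => _; rewrite /case_i /case_ii !in_g3E /isotropic !ext_projE E1 E2 /=.
rewrite !mulf_eq0 (negPf t0) !orbF => + f10 f20.
case=> [[/eqP b10 b20]|[b10 /eqP b20]].
- move: f10; rewrite b10 scale0r addr0 mul0r => f10.
  have a10 : a1 != 0.
    by apply: contraNneq f10 => ->; rewrite scale0r.
  rewrite !killingE // xx => /eqP; rewrite !mulr0 add0r !mulf_eq0 (negPf xy) (negPf a10).
  by rewrite (negPf b20).
- move: f20; rewrite b20 scale0r addr0 mul0r => f20 i1 _.
  have a20 : a2 != 0.
    by apply: contraNneq f20 => ->; rewrite scale0r.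
  have /eqP : 2 * (a1 * b1) * killing x y = 0.
    by rewrite -[RHS]i1 !killingE // xx yy (killingC dimL simpleL y x); ring.
  rewrite !mulf_eq0 pnatr_eq0 (negPf xy) (negPf b10) !orbF /= => /eqP a10.
  exists b1, a2; split=> //; last by rewrite ext_pairZ mulr0.
  by rewrite a10 scale0r add0r ext_pairZ.
Qed.

Lemma adapted_basis_frame (p : {vspace ext1 L}) : generating_plane p ->
  exists e1 e2 : ext1 L,
    [/\ adapted_basis p e1 e2,
        forall f1 f2 : ext1 L, adapted_basis p f1 f2 ->
          exists a b : R, [/\ a != 0, b != 0, f1 = a *: e1 & f2 = b *: e2]
      & frame_relations e1 e2].
Proof.
move=> /graph_plane_normal[x [y [t [t0 -> [xy|xy]]]]].
- have [eB uB] := adapted_basis_orthogonal xy t0.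
  exists (ext_pair x 0), (ext_pair y t); split=> //.
  by apply: frame_relationsP; [exact: gram_orthogonal | case: eB].
- have [eB uB] := adapted_basis_isotropic xy t0.
  exists (ext_pair y t), (ext_pair x 0); split=> //.
  apply: frame_relationsP; last by case: eB.
  have := gram_isotropic xy; rewrite /gram mulrC (killingC dimL simpleL y x); exact.
Qed.

End Frames.

(** * Automorphisms and equivalence of planes *)

Section Equivalence.
Variables (R : realType) (L : lieAlgType R).
Hypotheses (dimL : \dim {:L} = 3%N) (simpleL : simple_lie L).
Implicit Types (x y z u v : L) (s t r : R).

Definition same_gram x y x' y' : Prop :=
  [/\ killing x x = killing x' x', killing x y = killing x' y'
    & killing y y = killing y' y'].

Lemma same_gramC x y x' y' : same_gram x y x' y' -> same_gram x' y' x y.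
Proof. by case=> xx xy yy; split. Qed.

(** Map the basis [x], [y], [[< x, y >]] to its primed counterpart. By [bracket_bracket], the
    remaining brackets have coefficients that are Gram entries, so they are respected. *)
Lemma same_gram_hom x y x' y' : gram x y != 0 -> same_gram x y x' y' ->
  exists phi : 'End(L), [/\ phi x = x', phi y = y'
    & forall u v, phi [< u, v >] = [< phi u, phi v >]].
Proof.
move=> D0 [xx xy yy]; have f := gram_free3 dimL simpleL D0.
have [phi] := linear_of_free [:: x; y; [< x, y >]] [:: x'; y'; [< x', y' >]].
move=> /(_ f erefl) [ex ey ez]; exists (linfun phi).
split=> [||u v]; rewrite !lfunE //=.
have [a [b [c uE]]] := gram_span3 dimL simpleL u D0.
have [a' [b' [c' vE]]] := gram_span3 dimL simpleL v D0.
have phiE d d' d'' : phi (d *: x + d' *: y + d'' *: [< x, y >])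
    = d *: x' + d' *: y' + d'' *: [< x', y' >].
  by rewrite !linearD !linearZ /= ex ey ez.
rewrite uE vE !phiE !bracket_span3 !bracket_bracket // !(killingC dimL simpleL y).
rewrite (killingC dimL simpleL y') -xx -xy -yy.
rewrite !(linearD, linearZ, linearN) /= ex ey ez.
by vec_field.
Qed.

(** The homomorphism built in the opposite direction is the inverse: each composite fixes a pair
    that generates [L]. *)
Lemma same_gram_aut x y x' y' : gram x y != 0 -> same_gram x y x' y' ->
  exists phi : 'End(L), [/\ phi x = x', phi y = y' & automorphism phi].
Proof.
move=> D0 g; have D0' : gram x' y' != 0 by move: D0; case: g; rewrite /gram => -> -> ->.
have [phi [px py ph]] := same_gram_hom D0 g.
have [psi [qx qy qh]] := same_gram_hom D0' (same_gramC g).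
exists phi; split=> //; split=> //; exists psi => u.
  have [a [b [c ->]]] := gram_span3 dimL simpleL u D0.
  by rewrite !linearD !linearZ /= ph qh px py qx qy.
have [a [b [c ->]]] := gram_span3 dimL simpleL u D0'.
by rewrite !linearD !linearZ /= qh ph qx qy px py.
Qed.

Definition ext_map (phi : 'End(L)) s (v : ext1 L) : ext1 L :=
  ext_pair (phi v.1) (s * v.2).

Lemma ext_map_linear phi s : linear (ext_map phi s).
Proof.
move=> a u v; apply: ext_eq; rewrite /= ?linearP // mulrDr; congr (_ + _).
exact: mulrCA.
Qed.

HB.instance Definition _ phi s :=
  GRing.isLinear.Build R (ext1 L) (ext1 L) *:%R (ext_map phi s) (ext_map_linear phi s).

Lemma ext_map_aut phi s : s != 0 -> automorphism phi ->
  automorphism (linfun (ext_map phi s)).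
Proof.
move=> s0 [[psi phiK psiK] phiM]; split=> [|u v]; last first.
  by rewrite !lfunE !ext_bracketE /= /ext_map /= phiM mulr0.
exists (fun v : ext1 L => ext_pair (psi v.1) (s^-1 * v.2)) => v.
  by rewrite lfunE; apply: ext_eq; rewrite /= ?phiK // mulKf.
by rewrite lfunE; apply: ext_eq; rewrite /= ?psiK // mulVKf.
Qed.

(** Brackets have zero second component, so [g1] can be rescaled by any nonzero factor; the factor
    [t' / t] shows that [t] is no invariant. *)
Lemma same_gram_equivalent x y t x' y' t' : gram x y != 0 -> t != 0 -> t' != 0 ->
  same_gram x y x' y' -> equivalent (graph_plane x y t) (graph_plane x' y' t').
Proof.
move=> D0 t0 t0' /(same_gram_aut D0)[phi [px py aphi]].
exists (linfun (ext_map phi (t' / t))).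
  by apply: ext_map_aut; rewrite ?mulf_neq0 ?invr_eq0.
by rewrite limg_span /= !lfunE /= /ext_map /= px py mulr0 divfK.
Qed.

(* An automorphism preserves the center and the derived algebra, i.e. both
   summands of ext1 L, and acts on the first one by an isometry of killing. *)
Lemma ext_aut_killing (f : 'End(ext1 L)) : automorphism f ->
  (forall x, (f (ext_pair x 0)).2 = 0) /\
  (forall u v : ext1 L, killing (f u).1 (f v).1 = killing u.1 v.1).
Proof.
move=> [bf fM]; have [g fK gK] := bf.
have f2 x : (f (ext_pair x 0)).2 = 0.
  (* The preimage of [g3] contains every bracket of [L], since [f] sends brackets to brackets; hence
     it is all of [L]. *)
  suff : x \in (ext_inj L @^-1: (f @^-1: limg (ext_inj L)))%VS.
    by rewrite -!memv_preim ext_injE -[_ \in _]/(in_g3 _) in_g3E => /eqP.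
  suff -> : (ext_inj L @^-1: (f @^-1: limg (ext_inj L)))%VS = fullv by rewrite memvf.
  apply: (simple_perfect simpleL) => u v.
  rewrite -!memv_preim ext_injE -[_ \in _]/(in_g3 _) in_g3E.
  by rewrite -[(_, _)]/[< ext_pair u 0, ext_pair v 0 >] fM.
have center (c : ext1 L) : (forall u : ext1 L, [< c, u >] = 0) -> c.1 = 0.
  move=> c0; apply: (simple_center simpleL); first by rewrite dimL.
  by move=> y; have /ext_pair_eq0[] := c0 (ext_pair y 0).
have f01 s : (f (ext_pair 0 s)).1 = 0.
  apply: center => u; rewrite -[u]gK -fM ext_bracketE bracket0l.
  exact: linear0.
pose phi : 'End(L) := (ext_proj L \o f \o ext_inj L)%VF.
have phiI x : phi x = (f (ext_pair x 0)).1 by rewrite !comp_lfunE ext_projE ext_injE.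
have phiE (u : ext1 L) : (f u).1 = phi u.1.
  have -> : u = ext_pair u.1 0 + ext_pair 0 u.2.
    by apply: ext_eq; rewrite /= ?addr0 ?add0r.
  by rewrite linearD /= f01 !addr0 phiI.
have phiM x y : phi [< x, y >] = [< phi x, phi y >].
  by rewrite !phiI -[ext_pair _ 0]/[< ext_pair x 0, ext_pair y 0 >] fM.
have phi0 x : phi x = 0 -> x = 0.
  move=> px; apply: (@center (ext_pair x 0)) => u.
  by apply: (can_inj fK); rewrite fM linear0 ext_bracketE -phiI px bracket0l.
split=> // u v; rewrite !phiE; move: u.1 v.1 => x y; apply/eqP.
rewrite -subr_eq0; apply: contraT => d0.
(* Let [d w] be the defect of isometry on [(x, w)]. Applying [phi] to the double bracket of [x],
   [y], [z] and using injectivity gives [d y *: z = d z *: y]; with [d y != 0] this would make [L] a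
   line. *)
have yline : fullv = <[y]>%VS.
  apply/eqP; rewrite eq_sym eqEsubv subvf; apply/subvP => z _.
  pose d w := killing (phi x) (phi w) - killing x w.
  have E : d y *: phi z - d z *: phi y = 0.
    have H : (killing (phi x) (phi y) / 2) *: phi z - (killing (phi x) (phi z) / 2) *: phi y
        = (killing x y / 2) *: phi z - (killing x z / 2) *: phi y.
      by rewrite -bracket_bracket // -!phiM bracket_bracket // linearB !linearZ.
    transitivity (2 *: ((killing (phi x) (phi y) / 2) *: phi z
      - (killing (phi x) (phi z) / 2) *: phi y
      - ((killing x y / 2) *: phi z - (killing x z / 2) *: phi y))).
      by rewrite /d; vec_field.
    by rewrite H subrr scaler0.
  apply/vlineP; exists (d z / d y).
  apply: (scalerI d0); rewrite scalerA mulrC divfK //.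
  by apply/subr0_eq/phi0; rewrite -[RHS]E linearB !linearZ.
by have := dimL; rewrite yline dim_vline; case: (_ != 0).
Qed.

End Equivalence.

(** * Counting equivalence classes *)

Section Classes.
Variables (R : realType) (L : lieAlgType R).
Hypotheses (dimL : \dim {:L} = 3%N) (simpleL : simple_lie L).
Implicit Types (x y z u v : L) (s t r : R).

(** The automorphism preserves [g3], so on projections it sends [x] to [a *: x'] and [y] to
    [c *: x' + d *: y']. It preserves the form, so the two invariants change by the squares of [a]
    and [a * d]. *)
Lemma equivalent_sg x y t x' y' t' : gram x y != 0 -> t' != 0 ->
  equivalent (graph_plane x y t) (graph_plane x' y' t') ->
  Num.sg (killing x x) = Num.sg (killing x' x') /\
  Num.sg (gram x y) = Num.sg (gram x' y').
Proof.
move=> D0 t0' [f af fp]; have [f2 fk] := ext_aut_killing dimL simpleL af.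
have fm (u : ext1 L) : u \in [:: ext_pair x 0; ext_pair y t] -> f u \in graph_plane x' y' t'.
  by move=> us; rewrite -fp memv_img ?memv_span.
have [|a [b Ex]] := graph_plane_mem (fm (ext_pair x 0) _); first by rewrite mem_head.
have [|c [d Ey]] := graph_plane_mem (fm (ext_pair y t) _).
  by rewrite !inE eqxx orbT.
have b0 : b = 0.
  by have /eqP := f2 x; rewrite Ex /= mulf_eq0 (negPf t0') orbF => /eqP.
have fx : (f (ext_pair x 0)).1 = a *: x' by rewrite Ex b0 /= scale0r addr0.
have fy : (f (ext_pair y t)).1 = c *: x' + d *: y' by rewrite Ey.
have kxx : killing x x = a ^+ 2 * killing x' x'.
  have := fk (ext_pair x 0) (ext_pair x 0).
  by rewrite fx /= => <-; rewrite !killingE //; ring.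
have gE : gram x y = (a * d) ^+ 2 * gram x' y'.
  have := fk (ext_pair x 0) (ext_pair y t); have := fk (ext_pair y t) (ext_pair y t).
  rewrite fx fy /= /gram => <- <-.
  by rewrite kxx !killingE // (killingC dimL simpleL y' x'); ring.
have ad0 : a * d != 0 by apply: contraNneq D0; rewrite gE => ->; rewrite expr0n mul0r.
have a0 : a != 0 by apply: contraNneq ad0 => ->; rewrite mul0r.
have sgE (c0 r : R) : c0 != 0 -> Num.sg (c0 ^+ 2 * r) = Num.sg r.
  by move=> n0; rewrite sgrM gtr0_sg ?mul1r // exprn_even_gt0.
by rewrite kxx gE !sgE.
Qed.

Lemma square_scale (r s : R) : r != 0 -> Num.sg r = Num.sg s ->
  exists2 a : R, a != 0 & a ^+ 2 * r = s.
Proof.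
move=> r0 rs; have sr : 0 < s / r.
  by rewrite -sgr_gt0 sgrM -rs sgrV -expr2 sqr_sg r0.
exists (Num.sqrt (s / r)); first by rewrite sqrtr_eq0 -ltNge.
by rewrite sqr_sqrtr ?ltW // divfK.
Qed.

(** Rescaling [x] and [y] separately adjusts the two diagonal Gram entries by arbitrary positive
    factors. *)
Lemma orthogonal_equivalent x y t x' y' t' : orthogonal_pair x y ->
  killing x' y' = 0 -> t != 0 -> t' != 0 ->
  Num.sg (killing x x) = Num.sg (killing x' x') ->
  Num.sg (killing y y) = Num.sg (killing y' y') ->
  equivalent (graph_plane x y t) (graph_plane x' y' t').
Proof.
move=> xyo xy' t0 t0' sx sy; have [xy xx yy] := xyo.
have [a a0 ax] := square_scale xx sx; have [b b0 yb] := square_scale yy sy.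
rewrite -(graph_plane_scale x y t 0 a0 b0) scale0r addr0.
apply: same_gram_equivalent; rewrite ?mulf_neq0 //.
  by apply: gram_orthogonal; split; rewrite !killingE // ?xy ?mulr0 // !mulf_neq0.
by split; rewrite !killingE // ?xy ?xy' ?mulr0 // -?ax -?yb; ring.
Qed.

(** The only nonzero Gram entry is [killing x y], and rescaling [x] gives it any nonzero value. *)
Lemma isotropic_equivalent x y t x' y' t' : isotropic_pair x y ->
  isotropic_pair x' y' -> t != 0 -> t' != 0 ->
  equivalent (graph_plane x y t) (graph_plane x' y' t').
Proof.
move=> [xx yy xy] [xx' yy' xy'] t0 t0'.
have a0 : killing x' y' / killing x y != 0 by rewrite mulf_neq0 ?invr_eq0.
rewrite -(graph_plane_scale x y t 0 a0 (oner_neq0 R)) scale0r addr0 scale1r mul1r.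
apply: same_gram_equivalent => //.
  by apply: gram_isotropic; split; rewrite ?killingE // ?xx ?mulr0 // mulf_neq0.
by split; rewrite ?killingE // ?xx ?xx' ?yy ?yy' ?mulr0 // divfK.
Qed.

(** The third vector [[< x, y >]] is orthogonal to both and has square [- gram x y / 2], which is
    negative too. *)
Lemma negative_definite x y u : killing x y = 0 -> killing x x < 0 ->
  killing y y < 0 -> u != 0 -> killing u u < 0.
Proof.
move=> xy xx yy u0.
have D0 : gram x y != 0 by apply: gram_orthogonal; split; rewrite ?ltr0_neq0.
have [a [b [c uE]]] := gram_span3 dimL simpleL u D0.
pose z := [< x, y >]; have zz : killing z z < 0.
  by rewrite killing_bracket2 // /gram xy expr0n subr0 mulNr oppr_lt0 divr_gt0 // nmulr_rgt0.
have uuE : killing u u = a ^+ 2 * killing x x + b ^+ 2 * killing y y + c ^+ 2 * killing z z.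
  rewrite uE !killingE // !(killingC dimL simpleL [< x, y >]) (killingC dimL simpleL y x) xy.
  by rewrite killing_bracketl // killing_bracketr // /z; ring.
have sq r s : r < 0 -> s ^+ 2 * r <= 0 by move=> r0; rewrite nmulr_lle0 // sqr_ge0.
have sq0 r s : r < 0 -> s ^+ 2 * r = 0 -> s = 0.
  by move=> r0 /eqP; rewrite mulf_eq0 (negPf (ltr0_neq0 r0)) orbF expf_eq0 => /eqP.
have [sa sb sc] := And3 (sq _ a xx) (sq _ b yy) (sq _ c zz).
have le0 : killing u u <= 0 by rewrite uuE; lra.
rewrite lt_neqAle le0 andbT; apply: contraNneq u0; rewrite uuE => k0.
rewrite uE (sq0 _ a xx) 1?(sq0 _ b yy) 1?(sq0 _ c zz) ?scale0r ?addr0 //; lra.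
Qed.

(** On the orthogonal complement of [x], the square of [ad x] is multiplication by
    [killing x x / 2]. This evaluates the form without computing traces. *)
Lemma killing_eigenvalue x y a : killing x y = 0 -> y != 0 ->
  [< x, [< x, y >] >] = a *: y -> killing x x = 2 * a.
Proof.
move=> xy y0 /eqP; rewrite bracket_bracket // xy mul0r scale0r subr0 -subr_eq0 -scalerBl.
by rewrite scaler_eq0 (negPf y0) orbF subr_eq0 => /eqP <-; field.
Qed.

(** The form is negative definite, so isotropic pairs do not occur and all orthogonal pairs have the
    same signs. *)
Lemma g37_classes : is_g37 L -> exactly_n_classes (@generating_plane R L) 1.
Proof.
move=> [E1 [E2 [E3 [/basis_free /free_not0 Ef [E23 E31 E12]]]]].
have n1 : E1 != 0 by apply: Ef; rewrite !inE eqxx.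
have n2 : E2 != 0 by apply: Ef; rewrite !inE eqxx orbT.
have k12 : killing E1 E2 = 0 by rewrite -E31 killing_bracketr.
have k21 : killing E2 E1 = 0 by rewrite killingC.
have k11 : killing E1 E1 = -2.
  rewrite (@killing_eigenvalue E1 E2 (-1)) ?mulrN1 //.
  by rewrite E12 bracketC E31 scaleN1r.
have k22 : killing E2 E2 = -2.
  rewrite (@killing_eigenvalue E2 E1 (-1)) ?mulrN1 //.
  by rewrite (bracketC E2 E1) E12 bracketNr E23 scaleN1r.
have l1 : killing E1 E1 < 0 by rewrite k11 oppr_lt0.
have l2 : killing E2 E2 < 0 by rewrite k22 oppr_lt0.
have neg u : u != 0 -> killing u u < 0 by apply: negative_definite k12 _ _.
exists (fun=> graph_plane E1 E2 1); split=> [_|i j _|p].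
- apply: graph_plane_generating; rewrite ?oner_neq0 //.
  by apply: gram_orthogonal; split; rewrite ?ltr0_neq0.
- by rewrite !ord1.
move=> /(graph_plane_normal dimL simpleL)[x [y [t [t0 -> [xyo|[xx _ xy]]]]]]; exists ord0.
  have [xy xx yy] := xyo.
  have nz u : killing u u != 0 -> u != 0.
    by apply: contraNneq => ->; rewrite killing0l.
  by apply: orthogonal_equivalent; rewrite ?oner_neq0 // !ltr0_sg // neg // nz.
have /neg : x != 0 by apply: contraNneq xy => ->; rewrite killing0l.
by rewrite xx ltxx.
Qed.

Lemma g36_classes : is_g36 L -> exactly_n_classes (@generating_plane R L) 4.
Proof.
move=> [E1 [E2 [E3 [/basis_free /free_not0 Ef [E23 E31 E12]]]]].
have n1 : E1 != 0 by apply: Ef; rewrite !inE eqxx.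
have n2 : E2 != 0 by apply: Ef; rewrite !inE eqxx orbT.
have n3 : E3 != 0 by apply: Ef; rewrite !inE eqxx !orbT.
have k12 : killing E1 E2 = 0 by rewrite -E31 killing_bracketr.
have k32 : killing E3 E2 = 0 by rewrite -E31 killing_bracketl.
have k31 : killing E3 E1 = 0 by rewrite -E23 killing_bracketr.
have k23 : killing E2 E3 = 0 by rewrite killingC.
have k13 : killing E1 E3 = 0 by rewrite killingC.
have k11 : killing E1 E1 = 2.
  rewrite (@killing_eigenvalue E1 E2 1) ?mulr1 //.
  by rewrite E12 bracketNr bracketC opprK E31 scale1r.
have k22 : killing E2 E2 = 2.
  rewrite (@killing_eigenvalue E2 E3 1) ?mulr1 //.
  by rewrite E23 bracketC E12 opprK scale1r.
have k33 : killing E3 E3 = -2.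
  rewrite (@killing_eigenvalue E3 E1 (-1)) ?mulrN1 //.
  by rewrite E31 bracketC E23 scaleN1r.
(* The signs of [killing x x] and of the Gram determinant for these four pairs are [(+,+)], [(+,-)],
   [(-,-)] and [(0,-)], all distinct. *)
pose X (i : 'I_4) := [:: E1; E1; E3; E1 + E3]`_i.
pose Y (i : 'I_4) := [:: E2; E3; E1; E1 - E3]`_i.
have kX i : killing (X i) (X i) = [:: 2; 2; -2; 0]`_i.
  by case: i => [[|[|[|[|//]]]] i] //=; rewrite /X /= ?killingE // k11 k33 k13 k31; ring.
have kg i : gram (X i) (Y i) = [:: 4; -4; -4; -16]`_i.
  case: i => [[|[|[|[|//]]]] i] //=; rewrite /gram /X /Y /= ?killingE //
    ?k11 ?k33 ?k13 ?k31 ?k12 ?k22; ring.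
have g0 i : gram (X i) (Y i) != 0.
  by rewrite kg; case: i => [[|[|[|[|//]]]] i] //=; rewrite ?oppr_eq0 pnatr_eq0.
exists (fun i => graph_plane (X i) (Y i) 1); split=> [i|i j|p].
- exact: (graph_plane_generating dimL simpleL (g0 i) (oner_neq0 R)).
- move=> /(equivalent_sg (g0 i) (oner_neq0 R)); rewrite !kX !kg => -[].
  case: i j => [[|[|[|[|//]]]] i] [[|[|[|[|//]]]] j] /=;
    rewrite ?sgrN ?sgr0 ?(gtr0_sg (ltr0Sn R _)) => H1 H2; try exact: val_inj;
    exfalso; clear -H1 H2; lra.
move=> /(graph_plane_normal dimL simpleL)[x [y [t [t0 -> [xyo|xyi]]]]]; last first.
  exists (inord 3); apply: isotropic_equivalent => //; last exact: oner_neq0.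
  split; rewrite /X /Y inordK //= !killingE // k11 k33 k13 k31; try ring.
  apply: lt0r_neq0; lra.
have [xy xx yy] := xyo.
have c i : Num.sg (killing x x) = Num.sg (killing (X i) (X i)) ->
    Num.sg (killing y y) = Num.sg (killing (Y i) (Y i)) ->
    killing (X i) (Y i) = 0 ->
    exists i, equivalent (graph_plane x y t) (graph_plane (X i) (Y i) 1).
  by move=> sx sy kxy; exists i; apply: orthogonal_equivalent; rewrite ?oner_neq0.
have s2 : Num.sg 2 = 1 :> R by rewrite gtr0_sg.
(* Two negative squares would make the form negative definite, against [killing E1 E1 = 2]; the
   other sign patterns match representatives 2, 1 and 0. *)
move: xx yy; rewrite !neq_lt => /orP[lx|lx] /orP[ly|ly].
- by have := negative_definite xy lx ly n1; rewrite k11 ltNge ler0n.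
- by apply: (c (inord 2)); rewrite /X /Y inordK //= ?k33 ?k11 ?sgrN ?s2
    ?(ltr0_sg lx) ?(gtr0_sg ly).
- by apply: (c (inord 1)); rewrite /X /Y inordK //= ?k33 ?k11 ?sgrN ?s2
    ?(gtr0_sg lx) ?(ltr0_sg ly).
- by apply: (c (inord 0)); rewrite /X /Y inordK //= ?k22 ?k11 ?s2 ?(gtr0_sg lx) ?(gtr0_sg ly).
Qed.
End Classes.

Theorem theorem1 (R : realType) (g3 : lieAlgType R)
    (dim_g3 : \dim {:g3} = 3%N) (simple_g3 : simple_lie g3) :
  [/\ exists p : {vspace ext1 g3}, generating_plane p,
      forall p : {vspace ext1 g3}, \dim p = 2%N ->
        let p1 : {vspace g3} := (ext_proj g3 @: p)%VS in
        generating p <->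
        [/\ (ext_inj g3 @: p1)%VS <> p,
            \dim p1 = 2%N
          & killing_nondegenerate_on p1],
      is_g37 g3 -> exactly_n_classes (@generating_plane R g3) 1,
      is_g36 g3 -> exactly_n_classes (@generating_plane R g3) 4
    & forall p : {vspace ext1 g3}, generating_plane p ->
        exists e1 e2 : ext1 g3,
          [/\ adapted_basis p e1 e2,
              forall f1 f2 : ext1 g3, adapted_basis p f1 f2 ->
                exists a b : R,
                  [/\ a != 0, b != 0, f1 = a *: e1 & f2 = b *: e2]
            & frame_relations e1 e2]].
Proof.
split.
- have [x [y D0]] := exists_gram dim_g3 simple_g3.
  exists (graph_plane x y 1).
  exact: (graph_plane_generating dim_g3 simple_g3 D0 (oner_neq0 R)).
- exact: generating_plane_criterion dim_g3 simple_g3.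
- exact: g37_classes dim_g3 simple_g3.
- exact: g36_classes dim_g3 simple_g3.
- exact: adapted_basis_frame dim_g3 simple_g3.
Qed.
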